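(* Let $\lambda$ be a nonzero real number and $r\ge0$ an integer. For every integer $k\ge 0$, as power series in $t$, $$\frac{1}{k!}\Big(\frac{t}{1-\lambda t}\Big)^{k}\Big(\frac{1}{1-\lambda t}\Big)^{\frac{r}{\lambda}}=\sum_{n=k}^{\infty}L_{\lambda}^{r}(n,k)\frac{t^{n}}{n!}.$$
   Context: For nonzero real $\lambda$, the degenerate falling and rising factorials are $(x)_{0,\lambda}=1$, $(x)_{n,\lambda}=x(x-\lambda)\cdots(x-(n-1)\lambda)$ and $\langle x\rangle_{0,\lambda}=1$, $\langle x\rangle_{n,\lambda}=x(x+\lambda)\cdots(x+(n-1)\lambda)$ for $n\ge1$. The $\lambda$-analogues of the $r$-Lah numbers, $L_\lambda^r(n,k)$ ($0\le k\le n$), are defined by the polynomial identity $\langle x+r\rangle_{n,\lambda}=\sum_{k=0}^n L_\lambda^r(n,k)(x)_{k,\lambda}$ for $n\ge0$. Powers $\big(\frac{1}{1-\lambda t}\big)^{a}$ with real $a$ denote the usual binomial series in $t$. *)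

(* Defs.v *)
From HB Require Import structures.
From mathcomp Require Import all_boot all_order all_algebra.
From mathcomp Require Import boolp reals.
From mathcomp Require Import ring.

Set Implicit Arguments.
Unset Strict Implicit.
Unset Printing Implicit Defensive.

Import GRing.Theory Num.Theory.
Local Open Scope ring_scope.

(* Formal power series [\sum_n (coefs f n) t^n], with the Cauchy product.     *)

Record fps (R : fieldType) := FPS { coefs : nat -> R }.

Lemma fpsP (R : fieldType) (f g : fps R) : coefs f =1 coefs g -> f = g.
Proof. by case: f g => [f] [g] /= fg; congr FPS; apply/funext. Qed.

HB.instance Definition _ (R : fieldType) := gen_eqMixin (fps R).
HB.instance Definition _ (R : fieldType) := gen_choiceMixin (fps R).

Definition fps_zero (R : fieldType) : fps R := FPS (fun _ => 0).
Definition fps_opp (R : fieldType) (f : fps R) := FPS (fun n => - coefs f n).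
Definition fps_add (R : fieldType) (f g : fps R) :=
  FPS (fun n => coefs f n + coefs g n).
Definition fps_one (R : fieldType) : fps R := FPS (fun n => (n == 0%N)%:R).
Definition fps_mul (R : fieldType) (f g : fps R) :=
  FPS (fun n => \sum_(i < n.+1) coefs f i * coefs g (n - i)%N).
Definition fps_scale (R : fieldType) (a : R) (f : fps R) :=
  FPS (fun n => a * coefs f n).

Lemma fps_addA (R : fieldType) : associative (@fps_add R).
Proof. by move=> f g h; apply: fpsP => n /=; rewrite addrA. Qed.
Lemma fps_addC (R : fieldType) : commutative (@fps_add R).
Proof. by move=> f g; apply: fpsP => n /=; rewrite addrC. Qed.
Lemma fps_add0 (R : fieldType) : left_id (fps_zero R) (@fps_add R).
Proof. by move=> f; apply: fpsP => n /=; rewrite add0r. Qed.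
Lemma fps_addN (R : fieldType) :
  left_inverse (fps_zero R) (@fps_opp R) (@fps_add R).
Proof. by move=> f; apply: fpsP => n /=; rewrite addNr. Qed.

HB.instance Definition _ (R : fieldType) :=
  GRing.isZmodule.Build (fps R)
    (@fps_addA R) (@fps_addC R) (@fps_add0 R) (@fps_addN R).

Definition fps_trunc (R : fieldType) (N : nat) (f : fps R) : {poly R} :=
  \poly_(i < N.+1) coefs f i.

Lemma coefs_mul_trunc (R : fieldType) (N n : nat) (f g : fps R) :
  (n <= N)%N -> coefs (fps_mul f g) n = (fps_trunc N f * fps_trunc N g)`_n.
Proof.
move=> nN; rewrite coefM /=; apply: eq_bigr => i _.
by rewrite !coef_poly !ltnS (leq_trans (leq_ord i) nN)
  (leq_trans (leq_subr _ _) nN).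
Qed.

Lemma fps_mulC (R : fieldType) : commutative (@fps_mul R).
Proof.
by move=> f g; apply: fpsP => n; rewrite !(coefs_mul_trunc _ _ (leqnn n)) mulrC.
Qed.

Lemma fps_mulA (R : fieldType) : associative (@fps_mul R).
Proof.
move=> f g h; apply: fpsP => n; transitivity
  ((fps_trunc n f * (fps_trunc n g * fps_trunc n h))`_n).
  rewrite coefM [LHS]/=; apply: eq_bigr => i _.
  by rewrite -coefs_mul_trunc ?leq_subr// coef_poly ltnS leq_ord.
rewrite mulrA coefM [RHS]/=; apply: eq_bigr => i _.
by rewrite -coefs_mul_trunc ?leq_ord// coef_poly ltnS leq_subr.
Qed.

Lemma fps_mul1 (R : fieldType) : left_id (fps_one R) (@fps_mul R).
Proof.
move=> f; apply: fpsP => n /=.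
by rewrite big_ord_recl/= mul1r subn0 big1 ?addr0// => i _; rewrite mul0r.
Qed.

Lemma fps_mulDl (R : fieldType) :
  left_distributive (@fps_mul R) (@fps_add R).
Proof.
move=> f g h; apply: fpsP => n /=; rewrite -big_split/=.
by apply: eq_bigr => i _; rewrite mulrDl.
Qed.

Lemma fps_one_neq0 (R : fieldType) : fps_one R != fps_zero R.
Proof.
apply/eqP => /(congr1 (fun f => coefs f 0)) /= /eqP.
by rewrite oner_eq0.
Qed.

HB.instance Definition _ (R : fieldType) :=
  GRing.Zmodule_isComNzRing.Build (fps R) (@fps_mulA R) (@fps_mulC R)
    (@fps_mul1 R) (@fps_mulDl R) (@fps_one_neq0 R).

Lemma fps_scaleA (R : fieldType) (a b : R) (f : fps R) :
  fps_scale a (fps_scale b f) = fps_scale (a * b) f.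
Proof. by apply: fpsP => n /=; rewrite mulrA. Qed.
Lemma fps_scale1 (R : fieldType) : left_id 1 (@fps_scale R).
Proof. by move=> f; apply: fpsP => n /=; rewrite mul1r. Qed.
Lemma fps_scaleDr (R : fieldType) : right_distributive (@fps_scale R) +%R.
Proof. by move=> a f g; apply: fpsP => n /=; rewrite mulrDr. Qed.
Lemma fps_scaleDl (R : fieldType) (f : fps R) :
  {morph (@fps_scale R)^~ f : a b / a + b}.
Proof. by move=> a b; apply: fpsP => n /=; rewrite mulrDl. Qed.

HB.instance Definition _ (R : fieldType) :=
  GRing.Zmodule_isLmodule.Build R (fps R) (@fps_scaleA R) (@fps_scale1 R)
    (@fps_scaleDr R) (@fps_scaleDl R).

Lemma coefs0 (R : fieldType) n : coefs (0 : fps R) n = 0. Proof. by []. Qed.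
Lemma coefs1 (R : fieldType) n : coefs (1 : fps R) n = (n == 0%N)%:R.
Proof. by []. Qed.
Lemma coefsN (R : fieldType) (f : fps R) n : coefs (- f) n = - coefs f n.
Proof. by []. Qed.
Lemma coefsD (R : fieldType) (f g : fps R) n :
  coefs (f + g) n = coefs f n + coefs g n.
Proof. by []. Qed.
Lemma coefsB (R : fieldType) (f g : fps R) n :
  coefs (f - g) n = coefs f n - coefs g n.
Proof. by []. Qed.
Lemma coefsZ (R : fieldType) a (f : fps R) n : coefs (a *: f) n = a * coefs f n.
Proof. by []. Qed.
Lemma coefsM (R : fieldType) (f g : fps R) n :
  coefs (f * g) n = \sum_(i < n.+1) coefs f i * coefs g (n - i)%N.
Proof. by []. Qed.
Lemma coefs_sum (R : fieldType) (I : Type) (s : seq I) (F : I -> fps R) n :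
  coefs (\sum_(i <- s) F i) n = \sum_(i <- s) coefs (F i) n.
Proof. exact: (big_morph (fun f => coefs f n) (fun _ _ => erefl) erefl). Qed.

Lemma fps_scaleAl (R : fieldType) (a : R) (f g : fps R) :
  a *: (f * g) = a *: f * g.
Proof.
apply: fpsP => n; rewrite coefsZ !coefsM mulr_sumr.
by apply: eq_bigr => i _; rewrite coefsZ mulrA.
Qed.

HB.instance Definition _ (R : fieldType) :=
  GRing.Lmodule_isLalgebra.Build R (fps R) (@fps_scaleAl R).

Lemma coefs_exp_small (R : fieldType) (f : fps R) (m n : nat) :
  coefs f 0 = 0 -> (n < m)%N -> coefs (f ^+ m) n = 0.
Proof.
move=> f0; elim: m n => // m IHm n nm; rewrite exprS coefsM big1// => -[i /=].
rewrite ltnS => ilen _; case: i ilen => [|i] ilen; first by rewrite f0 mul0r.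
by rewrite IHm ?mulr0//; rewrite ltnS in nm; apply: leq_trans nm; rewrite ltn_subrL
  (leq_trans _ ilen).
Qed.

(* If [f = c (1 - u)] with [c != 0] and [u] without constant term, then       *)
(* [f^-1 = c^-1 \sum_m u ^+ m], where only [m <= n] matters in degree [n].    *)

Definition fps_unit (R : fieldType) : {pred fps R} :=
  fun f => coefs f 0 != 0.

Definition fps_inv (R : fieldType) (f : fps R) : fps R :=
  if coefs f 0 == 0 then f else
  FPS (fun n => (coefs f 0)^-1 *
    \sum_(m < n.+1) coefs ((1 - (coefs f 0)^-1 *: f) ^+ m) n).

Lemma fps_mulV (R : fieldType) :
  {in @fps_unit R, left_inverse 1 (@fps_inv R) *%R}.
Proof.
move=> f; rewrite unfold_in => f0; rewrite /fps_inv (negPf f0).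
set c := coefs f 0; set u : fps R := 1 - c^-1 *: f.
have u0 : coefs u 0 = 0 by rewrite coefsB coefs1 coefsZ mulVf ?subrr.
have fE : f = c *: (1 - u).
  by rewrite /u opprB addrC subrK scalerA divff ?scale1r.
apply: fpsP => n.
transitivity (coefs ((\sum_(m < n.+1) u ^+ m) * (1 - u)) n).
  rewrite fE !coefsM; apply: eq_bigr => i _.
  have ilen := leq_ord i; rewrite coefsZ [coefs (FPS _) _]/=.
  rewrite mulrA [_^-1 * _]mulrC -[_ * _ * c]mulrA mulVf ?mulr1//.
  congr (_ * _); rewrite coefs_sum; move: (nat_of_ord i) ilen => {i} i ilen.
  rewrite -(subnKC ilen) -addSn big_split_ord/=.
  rewrite [X in _ = _ + X]big1 ?addr0// => j _.
  by rewrite coefs_exp_small// addSn ltnS leq_addr.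
rewrite mulrC -opprB mulNr -subrX1 opprB coefsB coefs_exp_small ?subr0//.
Qed.

Lemma fps_unitP (R : fieldType) (f g : fps R) : g * f = 1 -> fps_unit f.
Proof.
move=> /(congr1 (fun h => coefs h 0)); rewrite coefsM big_ord1 subn0 coefs1.
by move=> gf; apply/negP => /eqP f0; move/eqP: gf; rewrite f0 mulr0 eq_sym oner_eq0.
Qed.

Lemma fps_invr_out (R : fieldType) :
  {in [predC @fps_unit R], @fps_inv R =1 id}.
Proof. by move=> f; rewrite inE unfold_in negbK /fps_inv => ->. Qed.

HB.instance Definition _ (R : fieldType) :=
  GRing.ComNzRing_hasMulInverse.Build (fps R)
    (@fps_mulV R) (@fps_unitP R) (@fps_invr_out R).

Definition fpsX (R : fieldType) : fps R := FPS (fun n => (n == 1%N)%:R).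

(* Generalized binomial coefficient [x choose n] and the binomial series      *)
(* [(1 + c t)^a = \sum_n (a choose n) c^n t^n] with arbitrary exponent [a].   *)
(* The power [(1 / (1 - c t))^a] is thus [binomial_series (- c) (- a)].       *)

Definition gbinom (R : numFieldType) (x : R) (n : nat) : R :=
  (\prod_(i < n) (x - i%:R)) / n`!%:R.

Definition binomial_series (R : numFieldType) (c a : R) : fps R :=
  FPS (fun n => gbinom a n * c ^+ n).

Lemma coefs_mul1DX (R : fieldType) (c : R) (f : fps R) (n : nat) :
  coefs ((1 + c *: fpsX R) * f) n.+1 = coefs f n.+1 + c * coefs f n.
Proof.
rewrite mulrDl mul1r coefsD; congr (_ + _).
rewrite -scalerAl coefsZ coefsM; congr (_ * _).
rewrite 2!big_ord_recl /= mul0r add0r mul1r subSS subn0 big1 ?addr0// => i _.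
by rewrite mul0r.
Qed.

Lemma gbinomS (R : numFieldType) (a : R) (n : nat) :
  gbinom (a + 1) n.+1 = gbinom a n.+1 + gbinom a n.
Proof.
have n1 : n.+1%:R != 0 :> R by rewrite pnatr_eq0.
have nf : n`!%:R != 0 :> R by rewrite pnatr_eq0 -lt0n fact_gt0.
rewrite /gbinom factS natrM big_ord_recl big_ord_recr/= subr0.
rewrite (eq_bigr (fun i : 'I_n => a - i%:R)); last first.
  by move=> i _; rewrite /bump/= add1n -natr1; ring.
by rewrite -natr1; field; rewrite nf natr1.
Qed.

Lemma binomial_seriesS (R : numFieldType) (c a : R) :
  binomial_series c (a + 1) = (1 + c *: fpsX R) * binomial_series c a.
Proof.
apply: fpsP => -[|n].
  rewrite coefsM big_ord1 coefsD coefs1 coefsZ /= mulr0 addr0 mul1r.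
  by rewrite /gbinom !big_ord0.
by rewrite coefs_mul1DX/= gbinomS exprS; ring.
Qed.

(* On natural and negative integer exponents [binomial_series] is the power   *)
(* in the ring of formal power series.                                        *)

Lemma binomial_series_nat (R : numFieldType) (c : R) (m : nat) :
  binomial_series c m%:R = (1 + c *: fpsX R) ^+ m.
Proof.
elim: m => [|m IHm]; last by rewrite -natr1 binomial_seriesS IHm exprS.
apply: fpsP => -[|n] /=; first by rewrite /gbinom big_ord0 fact0 divr1 mul1r.
by rewrite /gbinom big_ord_recl subr0 !mul0r.
Qed.

Lemma binomial_series_natN (R : numFieldType) (c : R) (m : nat) :
  binomial_series c (- m%:R) = (1 + c *: fpsX R)^-1 ^+ m.
Proof.
have U : (1 + c *: fpsX R) \is a GRing.unit.
  by rewrite unfold_in /= /fps_unit coefsD coefs1 coefsZ mulr0 addr0 oner_eq0.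
elim: m => [|m IHm].
  by rewrite oppr0 -[0]/(0%:R) binomial_series_nat expr0.
apply: (mulrI U); rewrite -binomial_seriesS -natr1 opprD addrNK IHm.
by rewrite exprS mulVKr.
Qed.

Definition dfall (R : comNzRingType) (lambda x : R) (n : nat) : R :=
  \prod_(i < n) (x - lambda *+ i).

Definition drise (R : comNzRingType) (lambda x : R) (n : nat) : R :=
  \prod_(i < n) (x + lambda *+ i).

(* [L] is a family of lambda-analogues of the r-Lah numbers: the defining     *)
(* identity in R[x]. Only the values [L n k] with [k <= n] are constrained.   *)

Definition is_rLah (R : fieldType) (lambda : R) (r : nat) (L : nat -> nat -> R) :=
  forall n : nat,
    drise lambda%:P ('X + r%:R) n
      = \sum_(k < n.+1) L n k *: dfall lambda%:P 'X k :> {poly R}.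

(* The identity determines [L n k] for [k <= n].                              *)

Lemma dfallX_monic (R : fieldType) (lambda : R) (n : nat) :
  dfall lambda%:P 'X n \is monic /\ size (dfall lambda%:P 'X n) = n.+1.
Proof.
have -> : dfall lambda%:P 'X n =
    \prod_(c <- [seq lambda *+ i | i <- iota 0 n]) ('X - c%:P).
  rewrite big_map -{2}(subn0 n) -/(index_iota 0 n) big_mkord.
  by apply: eq_bigr => i _; rewrite polyCMn.
split; first exact: monic_prod_XsubC.
by rewrite size_prod_XsubC size_map size_iota.
Qed.

Lemma dfallX_free (R : fieldType) (lambda : R) (n : nat) (c : nat -> R) :
  \sum_(k < n) c k *: dfall lambda%:P 'X k = 0 ->
  forall k, (k < n)%N -> c k = 0.
Proof.
elim: n => // n IHn; rewrite big_ord_recr/= => c0.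
have cn : c n = 0.
  have /(congr1 (fun p : {poly R} => p`_n)) := c0.
  rewrite coefD coefZ coef0 coef_sum big1 ?add0r => [|i _]; last first.
    by rewrite coefZ nth_default ?mulr0// (dfallX_monic lambda i).2.
  have [/monicP + s] := dfallX_monic lambda n.
  by rewrite lead_coefE s /= => ->; rewrite mulr1.
move=> k; rewrite ltnS leq_eqVlt => /orP[/eqP->//|].
by apply: IHn; rewrite cn scale0r addr0 in c0.
Qed.

Lemma is_rLah_unique (R : fieldType) (lambda : R) r L L' :
  is_rLah lambda r L -> is_rLah lambda r L' ->
  forall n k, (k <= n)%N -> L n k = L' n k.
Proof.
move=> LP LP' n k kn; apply/eqP; rewrite -subr_eq0; apply/eqP.
apply: (@dfallX_free _ lambda n.+1 (fun k => L n k - L' n k)) => //.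
under eq_bigr do rewrite scalerBl.
by rewrite sumrB -LP -LP' subrr.
Qed.

Lemma is_rLah_exists (R : fieldType) (lambda : R) r :
  exists L, is_rLah lambda r L.
Proof.
suff H n : exists l : nat -> R, drise lambda%:P ('X + r%:R) n
    = \sum_(k < n.+1) l k *: dfall lambda%:P 'X k.
  by have [L LP] := choice H; exists L.
elim: n => [|n [l IHn]].
  by exists (fun=> 1); rewrite big_ord1 /drise /dfall !big_ord0 scale1r.
pose m k := (if (k <= n)%N then (lambda *+ (k + n) + r%:R) * l k else 0)
            + (if k is j.+1 then l j else 0).
exists m; rewrite /drise big_ord_recr/= -/(drise _ _ n) IHn mulr_suml.
rewrite (eq_bigr (fun k : 'I_n.+1 => l k *: dfall lambda%:P 'X k.+1 +
    ((lambda *+ (k + n) + r%:R) * l k) *: dfall lambda%:P 'X k)); last first.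
  move=> k _; rewrite /dfall big_ord_recr/= -!mul_polyC polyCM polyCD.
  rewrite !polyCMn polyC1 mulrnDr; ring.
rewrite big_split/= addrC; under [RHS]eq_bigr do rewrite /m scalerDl.
rewrite [RHS]big_split/= [X in _ = X + _]big_ord_recr/= ltnn scale0r addr0.
congr (_ + _); first by apply: eq_bigr => i _; rewrite leq_ord.
by rewrite [RHS]big_ord_recl/= scale0r add0r.
Qed.

(* Main.v *)
(** The recurrence that the defining identity forces on [L n k] has the explicit
    solution [L n k = 'C(n, k) * drise lambda (r + lambda k) (n - k)].  On the
    other side, the generating function is
    [t^k (1 - lambda t)^(- (k + r / lambda)) / k!], whose coefficients the
    binomial series gives directly. *)
Require Import Defs.
From mathcomp Require Import all_boot all_order all_algebra.
From mathcomp Require Import reals.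
From mathcomp Require Import ring.

Import GRing.Theory Num.Theory.
Local Open Scope ring_scope.

Lemma drise_recr (R : comNzRingType) (lambda x : R) n :
  drise lambda x n.+1 = drise lambda x n * (x + lambda *+ n).
Proof. by rewrite /drise big_ord_recr. Qed.

Lemma drise_recl (R : comNzRingType) (lambda x : R) n :
  drise lambda x n.+1 = x * drise lambda (x + lambda) n.
Proof.
rewrite /drise big_ord_recl mulr0n addr0; congr (_ * _).
by apply: eq_bigr => i _; rewrite mulrS addrA.
Qed.

Lemma dfall_recr (R : comNzRingType) (lambda x : R) n :
  dfall lambda x n.+1 = dfall lambda x n * (x - lambda *+ n).
Proof. by rewrite /dfall big_ord_recr. Qed.

Definition rLah {R : comNzRingType} (lambda : R) (r n k : nat) : R :=
  'C(n, k)%:R * drise lambda (r%:R + lambda *+ k) (n - k).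

Lemma rLah_small (R : comNzRingType) (lambda : R) (r n k : nat) :
  (n < k)%N -> rLah lambda r n k = 0.
Proof. by move=> nk; rewrite /rLah bin_small ?mul0r. Qed.

Lemma rLahS0 (R : comNzRingType) (lambda : R) (r n : nat) :
  rLah lambda r n.+1 0 = (lambda *+ n + r%:R) * rLah lambda r n 0.
Proof. by rewrite /rLah !bin0 !subn0 drise_recr mulr0n; ring. Qed.

(** For [k < n] all three terms share one rising factorial; dividing it out leaves Pascal's rule and
    the absorption identity [(k + 1) C(n, k + 1) = (n - k) C(n, k)]. *)
Lemma rLahSS (R : comNzRingType) (lambda : R) (r n k : nat) :
  rLah lambda r n.+1 k.+1 =
  (lambda *+ (k.+1 + n) + r%:R) * rLah lambda r n k.+1 + rLah lambda r n k.
Proof.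
rewrite [rLah lambda r n.+1 _]/rLah subSS binS.
have [kn|nk|->] := ltngtP k n.
- have [m ->] : exists m, n = (k + m.+1)%N.
    by exists (n - k.+1)%N; rewrite addnS -addSn subnKC.
  (* Peeling the last factor on the left and the first factor of the [rLah lambda r n k] term
     exposes the common [drise lambda (r + lambda (k + 1)) m]. *)
  rewrite /rLah -addSnnS !addKn addSnnS addKn [in LHS]drise_recr drise_recl.
  have -> : r%:R + lambda *+ k + lambda = r%:R + lambda *+ k.+1.
    by rewrite -addrA -mulrSr.
  have /(congr1 (fun j => j%:R : R)) := mul_bin_left (k + m.+1) k.
  rewrite addKn !natrM => binE.
  rewrite natrD; set D := drise _ _ _.
  set b := 'C(_, k.+1)%:R in binE *; set c := 'C(_, k)%:R in binE *.
  rewrite -[lambda]mulr1 -!mulrnAr.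
  apply/eqP; rewrite -subr_eq0; apply/eqP.
  (* The difference of the two sides is a multiple of the absorption identity [binE]. *)
  transitivity (- lambda * D * (k.+1%:R * b - m.+1%:R * c)); last first.
    by rewrite binE subrr mulr0.
  by rewrite !natrD -!natr1; ring.
- by rewrite !rLah_small ?(leq_trans nk)// !bin_small ?(leq_trans nk)//; ring.
- rewrite rLah_small// mulr0 add0r /rLah bin_small// add0n !subnn.
  by rewrite /drise !big_ord0.
Qed.

Lemma rLahP (R : fieldType) (lambda : R) (r : nat) :
  is_rLah lambda r (rLah lambda r).
Proof.
elim=> [|n IHn].
  by rewrite big_ord1 /rLah /drise /dfall !big_ord0 bin0 mulr1 scale1r.
rewrite drise_recr IHn mulr_suml.
(* Split the new factor as [X + r + lambda n = (X - lambda k) + (lambda (k + n) + r)]: the first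
   part extends the falling factorial, the second is a scalar. *)
rewrite (eq_bigr (fun k : 'I_n.+1 =>
    ((lambda *+ (k + n) + r%:R) * rLah lambda r n k) *: dfall lambda%:P 'X k
    + rLah lambda r n k *: dfall lambda%:P 'X k.+1)); last first.
  move=> k _; rewrite dfall_recr; move: (rLah _ _ _ _) => l.
  rewrite -!mul_polyC polyCM polyCD !polyCMn polyC1.
  by rewrite mulrnDr; ring.
rewrite big_split/= [RHS]big_ord_recl/= rLahS0.
under [in RHS]eq_bigr => k _ do rewrite /bump add1n rLahSS scalerDl.
rewrite big_split/= addrA; congr (_ + _).
(* The scalar part has no term of index [n + 1], matching [rLah lambda r n n.+1 = 0]. *)
rewrite [in RHS]big_ord_recr/= (rLah_small _ _ _ n n.+1)// mulr0 scale0r addr0.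
by rewrite big_ord_recl/= add0n.
Qed.

(** Merges the factor [(1 - lambda t)^(-k)] with the power of real exponent [- r / lambda]. *)
Lemma binomial_series_subn (R : numFieldType) (c a : R) (m : nat) :
  binomial_series c (a - m%:R) =
  (1 + c *: fpsX R)^-1 ^+ m * binomial_series c a.
Proof.
have U : (1 + c *: fpsX R) \is a GRing.unit.
  by rewrite unfold_in /= /fps_unit coefsD coefs1 coefsZ mulr0 addr0 oner_eq0.
elim: m => [|m IHm]; first by rewrite subr0 expr0 mul1r.
apply: (mulrI U); rewrite -binomial_seriesS -natr1 opprD addrA addrNK IHm.
by rewrite exprS mulrA mulVKr.
Qed.

Lemma coefs_fpsXnM (R : fieldType) (f : fps R) (k n : nat) :
  coefs (fpsX R ^+ k * f) n = if (k <= n)%N then coefs f (n - k) else 0.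
Proof.
elim: k n => [|k IHk] n; first by rewrite mul1r subn0.
rewrite exprS -mulrA; case: n => [|n].
  by rewrite coefsM big_ord1 mul0r.
rewrite coefsM 2!big_ord_recl big1 ?addr0 => [|i _]; last by rewrite mul0r.
by rewrite mul0r add0r mul1r !subSS subn0 IHk.
Qed.

(** Each of the [n] factors [- a - i] absorbs one [- lambda] and becomes [lambda a + lambda i]. *)
Lemma coefs_binomial_series_drise (R : numFieldType) (lambda a : R) (n : nat) :
  coefs (binomial_series (- lambda) (- a)) n
  = drise lambda (lambda * a) n / n`!%:R.
Proof.
rewrite /= /gbinom mulrAC; congr (_ / _).
rewrite -[in X in _ * X](card_ord n) -prodr_const -big_split/=.
by apply: eq_bigr => i _; rewrite -mulr_natr; ring.
Qed.

Theorem theorem3p1 (R : realType) (lambda : R) (lambda_neq0 : lambda != 0)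
    (r : nat) (L : nat -> nat -> R) (L_rLah : is_rLah lambda r L) (k : nat) :
  (k`!%:R : R)^-1 *: (fpsX R / (1 - lambda *: fpsX R)) ^+ k
    * binomial_series (- lambda) (- (r%:R / lambda))
  = FPS (fun n => if (k <= n)%N then L n k / n`!%:R else 0).
Proof.
rewrite -scaleNr exprMn -scalerAl -mulrA -binomial_series_subn -opprD.
apply: fpsP => n; rewrite coefsZ coefs_fpsXnM [RHS]/=.
have [kn|_] := leqP k n; last by rewrite mulr0.
rewrite (is_rLah_unique L_rLah (rLahP _ _ _)) //.
rewrite coefs_binomial_series_drise /rLah mulrDr.
(* As [lambda] is nonzero, [lambda (r / lambda + k)] is the base point [r + lambda k] of [rLah]. *)
rewrite [lambda * (_ / _)]mulrCA mulfV// mulr1 mulr_natr.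
(* Writing [n! = C(n, k) k! (n - k)!] cancels the binomial in [rLah]. *)
rewrite -(bin_fact kn) !natrM; field.
by rewrite !pnatr_eq0 -!lt0n !fact_gt0 bin_gt0.
Qed.
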